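(* Let $\Sigma=(B,\sigma)$ be a signed graph whose underlying graph $B$ is a block that is neither a single edge nor a circle, and suppose $[e,C,+]$ is a positive battery. If $C$ has at least three bridges, then no edge of $B$ outside $C$ is a positive battery (i.e. every edge not in $C$ lies in either zero or at least two positive circles).
   Context: A signed graph $\Sigma=(G,\sigma)$ is a finite graph $G$ with signature $\sigma:E(G)\to\{+,-\}$. A circle is a connected 2-regular subgraph; its sign is the product of its edge signs. A block is a maximal subgraph without a cutpoint. For a circle $C$, a chord is an edge not in $C$ joining two distinct vertices of $C$; a bridge of $C$ is either a chord or a connected component $D$ of $G\setminus V(C)$ together with all edges joining $D$ to $C$. An edge $f$ is a positive battery if it lies in exactly one positive circle; $[e,C,+]$ means $C$ is a positive circle containing $e$ and is the only positive circle containing $e$. *)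

(* Defs.v *)
(* Finite signed (multi)graphs with possible loops.
   A graph is given by a finite vertex type V, a finite edge type E and two
   endpoint maps s t : E -> V (the edge f joins s f and t f; it is a loop
   iff s f = t f).  The signature is sigma : E -> bool, with
   sigma f = true meaning f is positive (+) and false meaning negative (-). *)
From mathcomp Require Import all_boot.
Set Implicit Arguments. Unset Strict Implicit. Unset Printing Implicit Defensive.

Section SignedGraph.
Variables (V E : finType) (s t : E -> V).

Definition incident (f : E) (x : V) : bool := (s f == x) || (t f == x).

Definition vset (A : {set E}) : {set V} := [set x | [exists f in A, incident f x]].

Definition adjV : rel V :=
  fun x y => [exists f, ((s f == x) && (t f == y)) || ((s f == y) && (t f == x))].

Definition connected_graph : Prop :=
  0 < #|V| /\ forall x y : V, connect adjV x y.

Definition cutpoint (v : V) : Prop :=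
  exists E1 : {set E}, [/\ E1 != set0, ~: E1 != set0 &
    forall x : V, (x \in vset E1) && (x \in vset (~: E1)) = (x == v)].

Definition is_block : Prop := connected_graph /\ forall v : V, ~ cutpoint v.

Definition single_edge : Prop := exists f : E, [set: E] = [set f] /\ s f != t f.

Definition deg (A : {set E}) (x : V) : nat :=
  \sum_(f in A) ((s f == x) + (t f == x)).

Definition adjE (A : {set E}) : rel E :=
  fun f g => [&& f \in A, g \in A & [exists x, incident f x && incident g x]].

Definition is_circle (C : {set E}) : bool :=
  [&& C != set0,
      [forall f in C, forall g in C, connect (adjE C) f g] &
      [forall x in vset C, deg C x == 2]].

Variable sigma : E -> bool.

Definition positive (C : {set E}) : bool := ~~ odd #|[set f in C | ~~ sigma f]|.

Definition pos_circles_through (f : E) : {set {set E}} :=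
  [set C : {set E} | [&& is_circle C, positive C & f \in C]].

Definition pos_battery (f : E) : bool := #|pos_circles_through f| == 1.

Definition battery_at (e : E) (C : {set E}) : Prop :=
  [/\ is_circle C, positive C, e \in C & pos_circles_through e = [set C]].

(* bridges of C: the chords, and the components of G \ V(C) (each taken
   with its attaching edges) *)
Definition chords (C : {set E}) : {set E} :=
  [set f | [&& f \notin C, s f \in vset C, t f \in vset C & s f != t f]].

Definition adj_out (C : {set E}) : rel V :=
  fun x y => [&& x \notin vset C, y \notin vset C & adjV x y].

Definition out_components (C : {set E}) : {set {set V}} :=
  [set [set y | connect (adj_out C) x y] | x in ~: vset C].

Definition num_bridges (C : {set E}) : nat :=
  #|chords C| + #|out_components C|.

End SignedGraph.

(* Main.v *)
(* Call an ear a path Q outside C that meets C exactly in its two distinct ends.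
   Of the two circles formed by Q and an arc of C, the one through e is negative
   by uniqueness of C, and as C is positive both are negative. Given two ears P
   and Q that are disjoint off C, replace an arc of C by Q (or, if their ends
   interlace, cross from one arc to the other along Q) to obtain a circle
   containing P and Q; it arises by adding two such negative circles, hence is
   positive. Since the graph has no cutpoint, every edge off C lies on an ear,
   contained in one bridge. With an ear P through f in its bridge and ears in
   two other bridges, f lies in two different positive circles. *)
Require Import Defs.
From mathcomp Require Import all_boot.
From mathcomp Require Import zify.
Set Implicit Arguments. Unset Strict Implicit. Unset Printing Implicit Defensive.

Lemma connect_stable (T : finType) (r : rel T) (P : T -> Prop) (x y : T) :
  (forall a b, P a -> r a b -> P b) -> connect r x y -> P x -> P y.
Proof.
move=> Pr /connectP[p]; elim: p x => [|a p IH] x /=; first by move=> _ ->.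
by case/andP=> rxa pa e Px; apply: (IH a) => //; apply: Pr rxa.
Qed.

Lemma disjoint_setUr (T : finType) (A B D : {set T}) : [disjoint A & B :|: D] = [disjoint A & B] && [disjoint A & D].
Proof. by rewrite -!setI_eq0 setIUr setU_eq0. Qed.

Lemma disjoint_setUl (T : finType) (A B D : {set T}) : [disjoint A :|: B & D] = [disjoint A & D] && [disjoint B & D].
Proof. by rewrite -!setI_eq0 setIUl setU_eq0. Qed.

(** * Simple paths with their edge and vertex sets *)

Section Paths.
Variables (V E : finType) (s t : E -> V).
Implicit Types (f g h : E) (x y z w u v : V) (A B C D P Q : {set E}).
Implicit Types (S T W : {set V}).

Notation incident := (incident s t).
Notation vset := (vset s t).
Notation deg := (deg s t).

Definition joins f x y := ((s f == x) && (t f == y)) || ((s f == y) && (t f == x)).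

Lemma adjVP x y : reflect (exists f, joins f x y) (adjV s t x y).
Proof. exact: existsP. Qed.

Lemma joinsC f x y : joins f x y = joins f y x.
Proof. by rewrite /joins orbC. Qed.

Lemma adjV_sym : symmetric (adjV s t).
Proof. by move=> x y; apply/adjVP/adjVP => -[f]; rewrite joinsC; exists f. Qed.

Lemma joins_incl f x y : joins f x y -> incident f x.
Proof. by rewrite /joins /Defs.incident; case/orP=> /andP[/eqP-> /eqP->]; rewrite eqxx ?orbT. Qed.

Lemma joins_incr f x y : joins f x y -> incident f y.
Proof. by rewrite joinsC; apply: joins_incl. Qed.

Lemma joins_st f : joins f (s f) (t f).
Proof. by rewrite /joins !eqxx. Qed.

Lemma incident_joins f x : incident f x -> exists y, joins f x y.
Proof.
by case/orP=> /eqP <-; [exists (t f) | exists (s f); rewrite joinsC]; apply: joins_st.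
Qed.

Lemma joins_incident f x y z : joins f x y -> incident f z -> z = x \/ z = y.
Proof.
by case/orP=> /andP[/eqP <- /eqP <-] /orP[] /eqP <-; auto.
Qed.

Lemma vsetP A x : reflect (exists2 f, f \in A & incident f x) (x \in vset A).
Proof.
rewrite inE; apply: (iffP existsP) => [[f /andP[]]|[f]]; first by exists f.
by move=> fA fx; exists f; rewrite fA.
Qed.

Lemma mem_vset A f x : f \in A -> incident f x -> x \in vset A.
Proof. by move=> fA fx; apply/vsetP; exists f. Qed.

(* A is the edge set and S the vertex set of a simple path from x to y; x = y is the trivial path. *)
Inductive spath : V -> V -> {set E} -> {set V} -> Prop :=
| spath_nil x : spath x x set0 [set x]
| spath_cons f x z y A S : joins f x z -> spath z y A S -> x \notin S ->
    spath x y (f |: A) (x |: S).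

Lemma spath_start x y A S : spath x y A S -> x \in S.
Proof. by case=> [a|f a c b B T _ _ _]; rewrite !inE eqxx. Qed.

Lemma spath_end x y A S : spath x y A S -> y \in S.
Proof. by elim=> [z|f a z b B T _ _ bT _]; rewrite !inE ?bT ?orbT. Qed.

Lemma spath_incident x y A S f z :
  spath x y A S -> f \in A -> incident f z -> z \in S.
Proof.
elim=> [a|g a c b B T jg pT IH aT]; first by rewrite in_set0.
rewrite !inE => /orP[/eqP-> /(joins_incident jg)[->|->]|fB /(IH fB)->].
- by rewrite eqxx.
- by rewrite (spath_start pT) orbT.
by rewrite orbT.
Qed.

Lemma spath_edge_noloop x y A S f : spath x y A S -> f \in A -> s f != t f.
Proof.
elim=> [a|g a c b B T jg pT IH aT]; first by rewrite in_set0.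
rewrite !inE => /orP[/eqP->|/IH//]; apply/eqP=> st.
have ac : a = c by case/orP: jg => /andP[/eqP<- /eqP<-].
by case/negP: aT; rewrite ac (spath_start pT).
Qed.

(* With both end terms on the left the formula also covers the trivial path. *)
Lemma spath_deg x y A S z :
  spath x y A S -> deg A z + ((z == x) + (z == y)) = (z \in S) * 2.
Proof.
elim=> [a|f a c b B T jf pT IH aT].
  by rewrite /deg big_set0 !inE; case: eqP.
have fB : f \notin B.
  by apply/negP=> /(spath_incident pT)/(_ (joins_incl jf)); apply/negP.
rewrite /deg big_setU1 //= -/(deg B z) !inE.
have -> : (s f == z) + (t f == z) = (z == a) + (z == c).
  by case/orP: jf => /andP[/eqP-> /eqP->]; rewrite ![_ == z]eq_sym // addnC.
move: IH; case: (z =P a) => [->|_] /=; last by clear; lia.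
have ac : (a == c) = false by apply/eqP=> ac; rewrite ac (spath_start pT) in aT.
rewrite ac (negPf aT); clear; lia.
Qed.

Lemma spath_cat x y z A B S T :
  spath x y A S -> spath y z B T -> (forall w, w \in S -> w \in T -> w = y) ->
  spath x z (A :|: B) (S :|: T).
Proof.
move=> p; elim: p z B T => [a|f a c b A' S' jf p IH aS] z B T q dis.
  rewrite set0U; have -> : [set a] :|: T = T; last by [].
  by apply/setUidPr; rewrite sub1set (spath_start q).
rewrite -!setUA; apply: (spath_cons jf).
  by apply: IH => // w wS; apply: dis; rewrite !inE wS orbT.
rewrite inE (negPf aS) /=; apply/negP=> aT; case/negP: aS.
by rewrite (dis a) ?(spath_end p) // !inE eqxx.
Qed.

Lemma spath_edge f x y : joins f x y -> x != y -> spath x y [set f] [set x; y].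
Proof.
move=> jf xy; rewrite -[[set f]]setU0.
by apply: (spath_cons jf); [apply: spath_nil | rewrite inE].
Qed.

Lemma spath_rev x y A S : spath x y A S -> spath y x A S.
Proof.
elim=> [a|f a c b B T jf p IH aT]; first exact: spath_nil.
have ac : c != a by apply: contraNneq aT => <-; apply: spath_start p.
have jf' : joins f c a by rewrite joinsC.
have := spath_cat IH (spath_edge jf' ac); rewrite [B :|: _]setUC [T :|: _]setUC.
have -> : [set c; a] :|: T = a |: T.
  apply/setP=> w; rewrite !inE; case: (w =P c) => [->|//].
  by rewrite (spath_start p) !orbT.
apply=> w wT; rewrite !inE => /orP[/eqP//|/eqP wa].
by rewrite wa (negPf aT) in wT.
Qed.

Lemma spath_split x y A S w : spath x y A S -> w \in S ->
  exists A1 A2 S1 S2, [/\ spath x w A1 S1, spath w y A2 S2, A = A1 :|: A2,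
    S = S1 :|: S2 & forall z, z \in S1 -> z \in S2 -> z = w].
Proof.
elim=> [a|f a c b B T jf p IH aT].
  rewrite inE => /eqP->; exists set0, set0, [set a], [set a].
  split; rewrite ?setUid //; try exact: spath_nil.
  by move=> z; rewrite inE => /eqP.
case: (w =P a) => [-> _|wa].
  exists set0, (f |: B), [set a], (a |: T); split.
  - exact: spath_nil.
  - exact: (spath_cons jf).
  - by rewrite set0U.
  - by rewrite setUA setUid.
  - by move=> z; rewrite inE => /eqP.
rewrite !inE => /orP[/eqP//|/IH[A1 [A2 [S1 [S2 [p1 p2 eB eT d]]]]]].
exists (f |: A1), A2, (a |: S1), S2; split; rewrite -?setUA ?eB ?eT //.
  by apply: (spath_cons jf p1); apply: contra aT => h; rewrite eT inE h.
move=> z; rewrite !inE => /orP[/eqP-> aS2|]; last exact: d.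
by rewrite eT inE aS2 orbT in aT.
Qed.

(** A common edge would have both ends equal to [w], but edges of a simple path are not loops. Since
    [w] is arbitrary, vertex-disjoint paths are covered too. *)
Lemma spath_disjoint x y x' y' A B S T w :
  spath x y A S -> spath x' y' B T -> (forall z, z \in S -> z \in T -> z = w) ->
  [disjoint A & B].
Proof.
move=> p q d; apply/pred0P=> f /=; apply/negP=> /andP[fA fB].
have/eqP[] := spath_edge_noloop p fA.
have is_ : incident f (s f) by rewrite /Defs.incident eqxx.
have it_ : incident f (t f) by rewrite /Defs.incident eqxx orbT.
have h z : incident f z -> z = w.
  by move=> fz; apply: d; [apply: (spath_incident p fA fz) | apply: (spath_incident q fB fz)].
by rewrite (h _ is_) (h _ it_).
Qed.

(** The edge [k] at the start may lie off the path, so one edge at a common start reaches every edge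
    of two paths. *)
Lemma spath_connect D x y A S k f : spath x y A S -> A \subset D -> k \in D ->
  incident k x -> f \in A -> connect (adjE s t D) k f.
Proof.
move=> p; elim: p k => [a|g a c b B T jg p IH aT] k AD kD ka; first by rewrite in_set0.
move: AD; rewrite subUset sub1set => /andP[gD BD].
have kg : connect (adjE s t D) k g.
  apply: connect1; rewrite /adjE kD gD /=; apply/existsP; exists a.
  by rewrite ka (joins_incl jg).
rewrite !inE => /orP[/eqP->//|fB]; apply: connect_trans kg _.
by apply: IH => //; apply: joins_incr jg.
Qed.

Lemma spath_first x y A S : spath x y A S -> x != y ->
  exists2 f, f \in A & incident f x.
Proof.
case=> [a|f a c b B T jf p aT _]; first by rewrite eqxx.
by exists f; rewrite ?inE ?eqxx //; apply: joins_incl jf.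
Qed.

Lemma spath_trivial x A S : spath x x A S -> S = [set x].
Proof.
move E1 : {2}x => y p; case: p E1 => [//|f a c b B T jf p aT ab].
by rewrite ab (spath_end p) in aT.
Qed.

(** The end of [f] visited first serves. Hence a path that meets a circle only in its last vertex
    has no edge on that circle. *)
Lemma spath_edge_not_end x y A S f : spath x y A S -> f \in A ->
  exists a, [/\ a \in S, a != y & incident f a].
Proof.
elim=> [a|g a c b B T jg p IH aT]; first by rewrite in_set0.
rewrite !inE => /orP[/eqP->|/IH[d [dT db fd]]].
  exists a; split; rewrite ?inE ?eqxx //; last exact: joins_incl jg.
  by apply: contraNneq aT => ->; apply: spath_end p.
by exists d; rewrite !inE dT orbT.
Qed.

(** * Degrees, and circles as unions of two paths *)

Lemma adjE_sym D : connect_sym (adjE s t D).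
Proof.
apply: sym_connect_sym => f g; rewrite /adjE andbCA; congr [&& _, _ & _].
by apply: eq_existsb => x; rewrite andbC.
Qed.

Lemma deg_setID A D x : A \subset D -> deg D x = deg A x + deg (D :\: A) x.
Proof. by move=> AD; rewrite /deg (big_setID A) /= (setIidPr AD). Qed.

Lemma deg_disjoint A B x : [disjoint A & B] -> deg (A :|: B) x = deg A x + deg B x.
Proof. by move=> d; rewrite /deg -bigU //; apply: eq_bigl => f; rewrite !inE. Qed.

Lemma deg_gt0 A f x : f \in A -> incident f x -> 0 < deg A x.
Proof.
move=> fA fx; rewrite /deg (bigD1 f) //= /Defs.incident in fx *.
by case/orP: fx => /eqP ->; rewrite eqxx; clear; lia.
Qed.

Lemma deg_gt0P A x : 0 < deg A x -> exists2 f, f \in A & incident f x.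
Proof.
move=> d; apply/vsetP; apply: contraLR d => nx; rewrite -eqn0Ngt /deg big1 // => f fA.
have : ~~ incident f x by apply: contra nx; apply: mem_vset.
by rewrite negb_or => /andP[/negPf-> /negPf->].
Qed.

(** Degrees add because [A] and [B] are disjoint: an inner vertex gets 2 from the only path through
    it, and [x] and [y] get 1 from each path. *)
Lemma two_paths_circle x y A B S T :
  spath x y A S -> spath x y B T -> x != y -> [disjoint A & B] ->
  (forall z, z \in S -> z \in T -> z = x \/ z = y) -> is_circle s t (A :|: B).
Proof.
move=> p q xy dAB d; have [a aA ax] := spath_first p xy.
have ca f : f \in A :|: B -> connect (adjE s t (A :|: B)) a f.
  rewrite inE => /orP[] h.
    by apply: (spath_connect p) => //; rewrite ?subsetUl ?inE ?aA.
  by apply: (spath_connect q) => //; rewrite ?subsetUr ?inE ?aA.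
apply/and3P; split.
- by apply/set0Pn; exists a; rewrite inE aA.
- apply/forall_inP=> f fD; apply/forall_inP=> g gD.
  by apply: (@connect_trans _ _ a); [rewrite adjE_sym|]; apply: ca.
apply/forall_inP=> z /vsetP[f fD fz].
have hz : (z \in S) || (z \in T).
  move: fD; rewrite inE => /orP[fA|fB].
    by rewrite (spath_incident p fA fz).
  by rewrite (spath_incident q fB fz) orbT.
apply/eqP; rewrite deg_disjoint //; have := spath_deg z p; have := spath_deg z q.
case: (z =P x) => [->|zx].
  by rewrite (spath_start p) (spath_start q) (negPf xy); clear; lia.
case: (z =P y) => [->|zy].
  by rewrite (spath_end p) (spath_end q); clear; lia.
case zS: (z \in S) hz; case zT: (z \in T) => //= _; try by clear; lia.
by case: (d _ zS zT).
Qed.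

Lemma circle_open C y : (forall f, s f != t f) -> is_circle s t C -> y \in vset C ->
  exists z A S g, [/\ spath z y A S, z != y, joins g z y, C = g |: A /\ g \notin A & S = vset C].
Proof.
move=> nl /and3P[_ /forall_inP Ccon /forall_inP Cdeg] yC.
have cdeg x : x \in vset C -> deg C x = 2 by move=> h; apply/eqP/Cdeg.
(* The path grows backwards from the trivial one at [y]; [n] bounds the number of edges of [C] not
   yet used. *)
suff H n : forall z A S, spath z y A S -> A \subset C -> S \subset vset C ->
    #|C| - #|A| <= n ->
    exists z A S g, [/\ spath z y A S, z != y, joins g z y, C = g |: A /\ g \notin A & S = vset C].
  by apply: (H #|C| y set0 [set y]); rewrite ?sub0set ?sub1set ?leq_subr //; apply: spath_nil.
elim: n => [|n IH] z A S p AC SC sz; have dz := spath_deg z p;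
  have zC := subsetP SC z (spath_start p); rewrite (spath_start p) eqxx in dz;
  have [] := @deg_gt0P (C :\: A) z; 
  try (by have := deg_setID z AC; rewrite cdeg //; move: dz; clear; lia).
  move=> g; rewrite inE => /andP[gA gC]; exfalso.
  have : A \proper C by apply/properP; split=> //; exists g.
  by move/proper_card; move: sz; clear; lia.
move=> g; rewrite inE => /andP[gA gC] /[dup] gz /incident_joins[w jg].
have gAC : g |: A \subset C by rewrite subUset sub1set gC.
have wC : w \in vset C by apply: (mem_vset gC); apply: joins_incr jg.
have zw : z != w.
  apply: contraNneq (nl g) => zw; move: jg; rewrite -zw /joins orbb.
  by case/andP=> /eqP-> /eqP->.
case wS: (w \in S); last first.
  apply: (IH w (g |: A) (w |: S)) => //.
  - by apply: (spath_cons _ p); [rewrite joinsC | rewrite wS].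
  - by rewrite subUset sub1set wC.
  - have : A \proper C by apply/properP; split=> //; exists g.
    by move/proper_card; rewrite cardsU1 gA; move: sz; clear; lia.
have dgA x : deg (g |: A) x = ((s g == x) + (t g == x)) + deg A x.
  by rewrite /deg big_setU1.
have sg x : (s g == x) + (t g == x) = (x == z) + (x == w).
  by case/orP: jg => /andP[/eqP-> /eqP->]; rewrite ![_ == x]eq_sym // addnC.
(* When [g] returns to the path, it can only return to [y]: any other vertex of [S] besides [z]
   already has degree 2 in [A], and [g] would be a third edge of [C] there. *)
have wy : w = y.
  apply/eqP; have := deg_setID w gAC; rewrite dgA sg (cdeg w) //.
  have := spath_deg w p; rewrite wS eqxx; case: (w == y) => //.
  by rewrite eq_sym (negPf zw); clear; lia.
subst w.
have eS x : x \in S -> deg (g |: A) x = 2.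
  by move=> xS; rewrite dgA sg; have := spath_deg x p; rewrite xS; clear; lia.
(* All vertices of [S] have degree 2 in [g |: A], so no further edge of [C] touches them, and
   connectedness of [C] leaves no other edge. *)
have CE : C = g |: A.
  apply/eqP; rewrite eqEsubset gAC andbT; apply/subsetP=> h hC.
  move/(_ g gC)/forall_inP/(_ h hC): Ccon => cgh.
  apply: (connect_stable (P := fun h => h \in g |: A) _ cgh); last by rewrite !inE eqxx.
  move=> a b aA /and3P[_ bC /existsP[x /andP[ax bx]]].
  have xS : x \in S.
    move: aA; rewrite !inE => /orP[/eqP eag|aA]; last exact: (spath_incident p aA).
    rewrite eag in ax; case: (joins_incident jg ax) => -> //.
    exact: spath_start p.
  have xC := subsetP SC x xS.
  apply/negPn/negP=> nb; have := deg_setID x gAC; rewrite cdeg // eS //.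
  have : 0 < deg (C :\: (g |: A)) x by apply: (@deg_gt0 _ b) => //; rewrite in_setD nb.
  by clear; lia.
exists z, A, S, g; split=> //; apply/eqP; rewrite eqEsubset SC /=.
apply/subsetP=> x /vsetP[h]; rewrite CE !inE => /orP[/eqP->|hA].
  by case/(joins_incident jg)=> ->; rewrite ?(spath_start p).
exact: (spath_incident p hA).
Qed.

(** Open [C] at [u] by removing an edge [g], cut the resulting path at [v], and give [g] back to the
    piece that does not contain [u]. *)
Lemma circle_split C u v : (forall f, s f != t f) -> is_circle s t C ->
  u \in vset C -> v \in vset C -> u != v ->
  exists A B S T, [/\ spath u v A S, spath u v B T, C = A :|: B /\ [disjoint A & B],
    vset C = S :|: T & forall z, z \in S -> z \in T -> z = u \/ z = v].
Proof.
move=> nl cC uC vC uv; have [z [A [S [g [p zu jg [CE gA] SE]]]]] := circle_open nl cC uC.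
have vS : v \in S by rewrite SE.
have [A1 [A2 [S1 [S2 [p1 p2 AE SE' d]]]]] := spath_split p vS.
exists (g |: A1), A2, (u |: S1), S2; split.
- apply: (spath_cons _ p1); first by rewrite joinsC.
  by apply/negP=> uS1; case/eqP: uv; apply: d; rewrite ?(spath_end p2).
- exact: spath_rev.
- split; first by rewrite CE AE setUA.
  rewrite disjoint_setUl disjoints1 (spath_disjoint p1 p2 d) andbT.
  by apply: contra gA; rewrite AE inE => ->; rewrite orbT.
- rewrite -SE SE'; apply/setP=> x; rewrite !inE; case: (x =P u) => [->|//].
  by rewrite (spath_end p2) orbT.
- move=> x; rewrite !inE => /orP[/eqP->|xS1]; first by left.
  by move=> xS2; right; apply: d.
Qed.

Lemma spath_vset x y A S : spath x y A S -> x != y -> S \subset vset A.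
Proof.
move=> p xy; apply/subsetP=> z zS; apply/vsetP/deg_gt0P.
have := spath_deg z p; rewrite zS; case: (z =P x) => [->|_]; last by case: eqP => _; clear; lia.
by rewrite (negPf xy); clear; lia.
Qed.

(** * Paths avoiding a vertex, and the absence of cutpoints *)

Lemma spath_hit z z' w W : connect [rel x y | [&& x != w, y != w & adjV s t x y]] z z' ->
  z != w -> z' \in W -> exists w' A S, [/\ spath z w' A S, w' \in W, w \notin S
    & forall x, x \in S -> x \in W -> x = w'].
Proof.
case/connectP=> p; elim: p z => [|a p IH] z /=.
  move=> _ -> zw zW; exists z, set0, [set z]; split=> //; first exact: spath_nil.
    by rewrite inE eq_sym.
  by move=> x; rewrite inE => /eqP.
case/andP=> /and3P[zw aw /adjVP[f jf]] pa e _ zW.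
(* A start in [W] gives the trivial path, a start already on the path found gives its tail, and
   otherwise the edge [f] is prepended. *)
have [w' [A [S [q w'W wS d]]]] := IH a pa e aw zW.
case zWW: (z \in W).
  exists z, set0, [set z]; split=> //; first exact: spath_nil.
    by rewrite inE eq_sym.
  by move=> x; rewrite inE => /eqP.
case zS: (z \in S).
  have [A1 [A2 [S1 [S2 [_ q2 _ SE _]]]]] := spath_split q zS.
  exists w', A2, S2; split=> //.
    by apply: contra wS => h; rewrite SE inE h orbT.
  by move=> x xS; apply: d; rewrite SE inE xS orbT.
exists w', (f |: A), (z |: S); split=> //.
- by apply: (spath_cons jf q); rewrite zS.
- by rewrite !inE negb_or eq_sym zw.
by move=> x; rewrite !inE => /orP[/eqP->|/d//]; rewrite zWW.
Qed.

(** If another edge meets the vertex [v] of a loop, then [v] separates the loop from the remaining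
    edges. If none does, connectedness makes the loop the only edge, and a single loop is a circle
    since it counts twice in the degree. *)
Lemma block_noloop : is_block s t -> ~ is_circle s t [set: E] -> forall f, s f != t f.
Proof.
case=> [[_ con] nocut] ncirc f; apply/eqP=> st; set v := s f in st.
have fv x : incident f x = (x == v).
  by rewrite /Defs.incident -st orbb eq_sym.
have [h /andP[hf hv]|none] := pickP (fun h => (h != f) && incident h v); last first.
  have loneV y : y = v.
    apply: (connect_stable (P := fun y => y = v) _ (con v y)) => // a b -> /adjVP[k jk].
    have /negbT := none k; rewrite (joins_incl jk) andbT negbK => /eqP kf.
    by apply/eqP; rewrite -fv -kf; apply: joins_incr jk.
  have lone h : h = f.
    apply/eqP; have /negbT := none h.
    by rewrite /Defs.incident (loneV (s h)) eqxx andbT negbK.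
  have setf : [set: E] = [set f] by apply/setP=> h; rewrite !inE (lone h) eqxx.
  apply: ncirc; apply/and3P; split.
  - by apply/set0Pn; exists f; rewrite inE.
  - by apply/forall_inP=> a _; apply/forall_inP=> b _; rewrite (lone a) (lone b).
  - by apply/forall_inP=> x _; rewrite setf /Defs.deg big_set1 (loneV x) -st eqxx.
apply: (nocut v); exists [set f]; split.
- by apply/set0Pn; exists f; rewrite inE.
- by apply/set0Pn; exists h; rewrite !inE.
move=> x; apply/andP/eqP=> [[/vsetP[g]]|->].
  by rewrite inE => /eqP-> ; rewrite fv => /eqP.
split; first by apply: (@mem_vset _ f); rewrite ?inE ?fv.
by apply: (@mem_vset _ h); rewrite ?inE.
Qed.

(** Otherwise the edges touching the component of [z] in the graph without [w] share only the vertex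
    [w] with the remaining edges, so [w] is a cutpoint. *)
Lemma block_connect_avoid f h w z z' : is_block s t -> joins f w z -> joins h w z' ->
  z != w -> z' != w -> connect [rel x y | [&& x != w, y != w & adjV s t x y]] z z'.
Proof.
move=> [_ nocut] jf jh zw z'w; set r := [rel x y | _]; apply/negPn/negP=> nc.
pose E1 := [set g | [exists x, connect r z x && incident g x]].
have inE1 g x : connect r z x -> incident g x -> g \in E1.
  by move=> cx gx; rewrite inE; apply/existsP; exists x; rewrite cx.
have cw x : connect r z x -> x != w.
  by move=> cx; apply: (connect_stable (P := fun x => x != w) _ cx) => // a b _ /and3P[].
have fE1 : f \in E1 by apply: (inE1 _ z) => //; apply: joins_incr jf.
have hE1 : h \notin E1.
  apply/negP; rewrite inE => /existsP[x /andP[cx /(joins_incident jh)[] xE]].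
    by move: (cw x cx); rewrite xE eqxx.
  by rewrite -xE cx in nc.
apply: (nocut w); exists E1; split.
- by apply/set0Pn; exists f.
- by apply/set0Pn; exists h; rewrite inE.
move=> x; apply/andP/eqP=> [[/vsetP[g gE1 gx] /vsetP[k kE1 kx]]|->]; last first.
  split; first exact: mem_vset fE1 (joins_incl jf).
  by apply: mem_vset (joins_incl jh); rewrite inE.
apply/eqP/negPn/negP=> xw; rewrite inE in kE1; case/negP: kE1.
apply: (inE1 _ x) => //; move: gE1; rewrite inE => /existsP[y /andP[cy gy]].
have [b jb] := incident_joins gx; case: (joins_incident jb gy) => [<-//|yb].
apply: (connect_trans cy); apply: connect1; rewrite /= xw (cw y cy) /=.
by apply/adjVP; exists g; rewrite joinsC yb.
Qed.

End Paths.

(** * Ears of a circle, and parity of negative edges *)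

Section Ears.
Variables (V E : finType) (s t : E -> V).
Implicit Types (f g h : E) (x y z w u v : V) (A B C D P Q R Z : {set E}).
Implicit Types (S T W : {set V}).

Notation incident := (incident s t).
Notation vset := (vset s t).
Notation spath := (spath s t).
Notation joins := (joins s t).

(** The clause [ear_disjoint] excludes a single edge of [C] with distinct ends, which satisfies all
    the others. *)
Record ear C u v Q S : Prop := Ear {
  ear_path : spath u v Q S;
  ear_neq : u != v;
  ear_l : u \in vset C;
  ear_r : v \in vset C;
  ear_meet : forall z, z \in S -> z \in vset C -> z = u \/ z = v;
  ear_disjoint : [disjoint Q & C] }.

Lemma ear_sym C u v Q S : ear C u v Q S -> ear C v u Q S.
Proof.
case=> p n l r m d; split=> //; [exact: spath_rev | by rewrite eq_sym |].
by move=> z zS /(m z zS)[]; auto.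
Qed.

Lemma ear_new_edge C u v Q S : ear C u v Q S -> exists2 q, q \in Q & q \notin C.
Proof.
case=> p n _ _ _ d; have [q qQ _] := spath_first p n; exists q => //.
by rewrite (disjointFr d qQ).
Qed.

Variable sigma : E -> bool.

Definition neg A := odd #|[set f in A | ~~ sigma f]|.

Lemma positiveE A : positive sigma A = ~~ neg A. Proof. by []. Qed.

Lemma negU A B : [disjoint A & B] -> neg (A :|: B) = neg A (+) neg B.
Proof.
move=> d; rewrite /neg -oddD; congr odd.
have -> : [set f in A :|: B | ~~ sigma f]
  = [set f in A | ~~ sigma f] :|: [set f in B | ~~ sigma f].
  by apply/setP=> f; rewrite !inE andb_orl.
rewrite cardsU (_ : _ :&: _ = set0) ?cards0 ?subn0 //.
apply/setP=> f; rewrite !inE; apply/negP=> /andP[/andP[fA _] /andP[fB _]].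
by rewrite (disjointFr d fA) in fB.
Qed.

(** * Signs of ears, and positive circles through two ears *)

Section Battery.
Variables (e : E) (C : {set E}).
Hypothesis nl : forall f, s f != t f.
Hypothesis bat : battery_at s t sigma e C.

Lemma battery_unique Z : is_circle s t Z -> ~~ neg Z -> e \in Z -> Z = C.
Proof.
case: bat => _ _ _ U cZ nZ eZ; apply/set1P; rewrite -U inE; apply/and3P; split=> //.
Qed.

Lemma ear_arc_neg u v Q S A B T1 T2 : ear C u v Q S ->
  spath u v A T1 -> spath u v B T2 -> C = A :|: B -> [disjoint A & B] ->
  neg Q (+) neg A.
Proof.
move=> eQ pA pB CE dAB.
(* The arc containing [e]: together with [Q] it is a circle through [e] other than [C], as [Q] has
   an edge off [C], so it cannot be positive. *)
have half A' T' : spath u v A' T' -> A' \subset C -> e \in A' -> neg Q (+) neg A'.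
  move=> p sub eA'; have d : [disjoint Q & A'].
    exact: disjointWr sub (ear_disjoint eQ).
  rewrite -negU //; apply/negPn/negP=> pos.
  have [q qQ] := ear_new_edge eQ; rewrite -(@battery_unique (Q :|: A')) //.
  - by rewrite inE qQ.
  - apply: (two_paths_circle (ear_path eQ) p (ear_neq eQ) d) => z zS zT.
    apply: (ear_meet eQ zS); have := subsetP (spath_vset p (ear_neq eQ)) z zT.
    by case/vsetP=> f fA' fz; apply: (mem_vset (subsetP sub f fA')).
  - by rewrite inE eA' orbT.
(* As [C] is positive, [A] and [B] have the same sign, so an arc without [e] inherits the conclusion
   from the other arc. *)
case: bat => _ pC eC _; rewrite positiveE CE negU // in pC.
move: eC; rewrite CE inE => /orP[eA|eB].
  by apply: (half A T1); rewrite // CE subsetUl.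
have := half B T2 pB; rewrite CE subsetUr eB => /(_ isT isT).
by move: pC; case: (neg Q); case: (neg A); case: (neg B).
Qed.

(** The upper bound on [Z] will tell apart the circles obtained from ears in different bridges. *)
Definition joint_circle P Q := exists Z, [/\ is_circle s t Z, ~~ neg Z,
  P \subset Z, Q \subset Z & Z \subset P :|: Q :|: C].

(* Reroute the arc A, which P does not use, through Q: both changes of sign cancel. *)
Lemma joint_circle_nested P Q SP SQ u v x y A1 A2 A3 B S1 S2 S3 SB :
  ear C u v P SP -> ear C x y Q SQ -> [disjoint P & Q] ->
  (forall z, z \in SP -> z \in SQ -> z \in vset C) ->
  spath u x A1 S1 -> spath x y A2 S2 -> spath y v A3 S3 -> spath u v B SB ->
  C = A1 :|: A2 :|: A3 :|: B -> [disjoint A1 :|: A2 :|: A3 & B] ->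
  vset C = S1 :|: S2 :|: S3 :|: SB ->
  (forall z, z \in S1 -> z \in S2 -> z = x) ->
  (forall z, z \in S2 -> z \in S3 -> z = y) ->
  (forall z, z \in S1 -> z \in S3 -> False) ->
  (forall z, z \in S1 :|: S2 :|: S3 -> z \in SB -> z = u \/ z = v) ->
  joint_circle P Q.
Proof.
move=> eP eQ dPQ mPQ p1 p2 p3 pB CE dAB VE m12 m23 m13 mB.
have V1 z : z \in S1 -> z \in vset C by move=> h; rewrite VE !inE h.
have V3 z : z \in S3 -> z \in vset C by move=> h; rewrite VE !inE h !orbT.
have d12 := spath_disjoint p1 p2 m12.
have d23 := spath_disjoint p2 p3 m23.
have d13 : [disjoint A1 & A3].
  by apply: (spath_disjoint (w := u) p1 p3) => z z1 /(m13 z z1).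
have pA : spath u v (A1 :|: A2 :|: A3) (S1 :|: S2 :|: S3).
  apply: (spath_cat (spath_cat p1 p2 m12) p3) => z; rewrite inE => /orP[|]; last exact: m23.
  by move=> z1 /(m13 z z1).
have nP := ear_arc_neg eP pA pB CE dAB.
(* The other arc of [C] between [x] and [y]: back to [u], along [B] to [v], and back to [y]. *)
have pO : spath x y (A1 :|: B :|: A3) (S1 :|: SB :|: S3).
  apply: (spath_cat _ (spath_rev p3)).
    apply: (spath_cat (spath_rev p1) pB) => z z1 zB.
    have [|//|zv] := mB z _ zB; first by rewrite !inE z1.
    by case: (m13 z z1); rewrite zv; apply: spath_end p3.
  move=> z; rewrite inE => /orP[z1 /(m13 z z1)//|zB z3].
  have [|zu|//] := mB z _ zB; first by rewrite !inE z3 !orbT.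
  by case: (m13 z) => //; rewrite zu; apply: spath_start p1.
have dAB' := dAB; rewrite !disjoint_setUl in dAB'; case/andP: dAB' => /andP[d1B d2B] d3B.
have nQ : neg Q (+) neg A2.
  apply: (ear_arc_neg eQ p2 pO).
    by rewrite CE; apply/setP=> f; rewrite !inE; do !case: (f \in _).
  by rewrite !disjoint_setUr d2B d23 disjoint_sym d12.
have dQ D : D \subset C -> [disjoint Q & D] by move/disjointWr; apply; apply: ear_disjoint eQ.
have dP D : D \subset C -> [disjoint P & D] by move/disjointWr; apply; apply: ear_disjoint eP.
have s1 : A1 \subset C by rewrite CE -!setUA subsetUl.
have s3 : A3 \subset C by rewrite CE; apply/subsetP=> f fA; rewrite !inE fA !orbT.
have pR : spath u v (A1 :|: Q :|: A3) (S1 :|: SQ :|: S3).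
  apply: (spath_cat _ p3).
    apply: (spath_cat p1 (ear_path eQ)) => z z1 zQ.
    have [//|zy] := ear_meet eQ zQ (V1 _ z1).
    by case: (m13 z z1); rewrite zy; apply: spath_start p3.
  move=> z; rewrite inE => /orP[z1 /(m13 z z1)//|zQ z3].
  have [zx|//] := ear_meet eQ zQ (V3 _ z3).
  by case: (m13 z) => //; rewrite zx; apply: spath_end p1.
have dPR : [disjoint P & A1 :|: Q :|: A3] by rewrite !disjoint_setUr dPQ !dP.
have d1Q : [disjoint A1 & Q] by rewrite disjoint_sym dQ.
exists (P :|: (A1 :|: Q :|: A3)); split.
- apply: (two_paths_circle (ear_path eP) pR (ear_neq eP) dPR) => z zP zR.
  apply: (ear_meet eP zP); move: zR; rewrite !in_setU => /orP[/orP[/V1//|/(mPQ z zP)//]|/V3//].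
- rewrite (negU dPR) negU ?disjoint_setUl ?d13 ?dQ // (negU d1Q).
  move: nP nQ; rewrite negU ?disjoint_setUl ?d13 ?d23 // (negU d12).
  by case: (neg P); case: (neg Q); case: (neg A1); case: (neg A2); case: (neg A3).
- exact: subsetUl.
- by apply/subsetP=> f fQ; rewrite !inE fQ !orbT.
- apply/subsetP=> f; rewrite !inE => /or3P[->//|/orP[/(subsetP s1)->|->]|/(subsetP s3)->];
  by rewrite ?orbT.
Qed.

(** The circle runs from [u] along [A1] to [x], through [Q] to [y], along [B2] to [v] and back
    through [P]. It is the sum of the negative circles [P] with [A1], [A2] and [Q] with [A2], [B2],
    in which [A2] cancels. *)
Lemma joint_circle_crossing P Q SP SQ u v x y A1 A2 B1 B2 S1 S2 T1 T2 :
  ear C u v P SP -> ear C x y Q SQ -> [disjoint P & Q] ->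
  (forall z, z \in SP -> z \in SQ -> z \in vset C) ->
  spath u x A1 S1 -> spath x v A2 S2 -> spath u y B1 T1 -> spath y v B2 T2 ->
  C = A1 :|: A2 :|: (B1 :|: B2) -> [disjoint A1 :|: A2 & B1 :|: B2] ->
  vset C = S1 :|: S2 :|: (T1 :|: T2) ->
  (forall z, z \in S1 -> z \in S2 -> z = x) ->
  (forall z, z \in T1 -> z \in T2 -> z = y) ->
  (forall z, z \in S1 :|: S2 -> z \in T1 :|: T2 -> z = u \/ z = v) ->
  x \notin T1 :|: T2 -> y \notin S1 :|: S2 ->
  joint_circle P Q.
Proof.
move=> eP eQ dPQ mPQ p1 p2 q1 q2 CE dAB VE m12 k12 mAB xT yS.
have V1 z : z \in S1 -> z \in vset C by move=> h; rewrite VE !inE h.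
have V4 z : z \in T2 -> z \in vset C by move=> h; rewrite VE !inE h !orbT.
have uS2 : u \notin S2.
  apply/negP=> h; have ux := m12 _ (spath_start p1) h.
  by rewrite -ux inE (spath_start q1) in xT.
have vS1 : v \notin S1.
  apply/negP=> h; have vx := m12 _ h (spath_end p2).
  by rewrite -vx inE (spath_end q2) orbT in xT.
have uT2 : u \notin T2.
  apply/negP=> h; have uy := k12 _ (spath_start q1) h.
  by rewrite -uy inE (spath_start p1) in yS.
have vT1 : v \notin T1.
  apply/negP=> h; have vy := k12 _ h (spath_end q2).
  by rewrite -vy inE (spath_end p2) orbT in yS.
have d12 := spath_disjoint p1 p2 m12.
have e12 := spath_disjoint q1 q2 k12.
have pA := spath_cat p1 p2 m12.
have pB := spath_cat q1 q2 k12.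
have nP := ear_arc_neg eP pA pB CE dAB.
(* The two arcs of [C] between [x] and [y]: this one passes through [v], and [pO] passes through
   [u]. *)
have pI : spath x y (A2 :|: B2) (S2 :|: T2).
  apply: (spath_cat p2 (spath_rev q2)) => z z2 zT.
  have [||zu|//] := mAB z; rewrite ?inE ?z2 ?zT ?orbT //.
  by rewrite -zu z2 in uS2.
have pO : spath x y (A1 :|: B1) (S1 :|: T1).
  apply: (spath_cat (spath_rev p1) q1) => z z1 zT.
  have [||//|zv] := mAB z; rewrite ?inE ?z1 ?zT ?orbT //.
  by rewrite -zv z1 in vS1.
have dAB' := dAB; rewrite !disjoint_setUl !disjoint_setUr in dAB'.
case/andP: dAB' => /andP[d11 d1B2] /andP[d2B1 d22].
have nQ : neg Q (+) neg (A2 :|: B2).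
  apply: (ear_arc_neg eQ pI pO).
    by rewrite CE; apply/setP=> f; rewrite !inE; do !case: (f \in _).
  by rewrite !disjoint_setUl !disjoint_setUr d2B1 disjoint_sym d12 disjoint_sym d1B2 disjoint_sym e12.
have dQ D : D \subset C -> [disjoint Q & D] by move/disjointWr; apply; apply: ear_disjoint eQ.
have dP D : D \subset C -> [disjoint P & D] by move/disjointWr; apply; apply: ear_disjoint eP.
have s1 : A1 \subset C by rewrite CE -!setUA subsetUl.
have s4 : B2 \subset C by rewrite CE; apply/subsetP=> f fA; rewrite !inE fA !orbT.
have pR : spath u v (A1 :|: Q :|: B2) (S1 :|: SQ :|: T2).
  apply: (spath_cat _ q2).
    apply: (spath_cat p1 (ear_path eQ)) => z z1 zQ.
    have [//|zy] := ear_meet eQ zQ (V1 _ z1).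
    by rewrite -zy inE z1 in yS.
  move=> z; rewrite inE => /orP[z1 zT|zQ zT].
    have [||zu|zv] := mAB z; rewrite ?inE ?z1 ?zT ?orbT //.
      by rewrite -zu zT in uT2.
    by rewrite -zv z1 in vS1.
  have [zx|//] := ear_meet eQ zQ (V4 _ zT).
  by rewrite -zx inE zT orbT in xT.
have dPR : [disjoint P & A1 :|: Q :|: B2] by rewrite !disjoint_setUr dPQ !dP.
have d1Q : [disjoint A1 & Q] by rewrite disjoint_sym dQ.
exists (P :|: (A1 :|: Q :|: B2)); split.
- apply: (two_paths_circle (ear_path eP) pR (ear_neq eP) dPR) => z zP zR.
  apply: (ear_meet eP zP); move: zR; rewrite !in_setU => /orP[/orP[/V1//|/(mPQ z zP)//]|/V4//].
- rewrite (negU dPR) negU ?disjoint_setUl ?d1B2 ?dQ // (negU d1Q).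
  move: nP nQ; rewrite (negU d12) (negU d22).
  by case: (neg P); case: (neg Q); case: (neg A1); case: (neg A2); case: (neg B2).
- exact: subsetUl.
- by apply/subsetP=> f fQ; rewrite !inE fQ !orbT.
- apply/subsetP=> f; rewrite !inE => /or3P[->//|/orP[/(subsetP s1)->|->]|/(subsetP s4)->];
  by rewrite ?orbT.
Qed.

(** Cutting [A] at [x] and then at [y] gives the nested configuration, with [Q] reversed when [y]
    comes before [x]. Trivial pieces account for ears that share ends. *)
Lemma joint_circle_same_arc P Q SP SQ u v x y A B S T :
  ear C u v P SP -> ear C x y Q SQ -> [disjoint P & Q] ->
  (forall z, z \in SP -> z \in SQ -> z \in vset C) ->
  spath u v A S -> spath u v B T -> C = A :|: B -> [disjoint A & B] ->
  vset C = S :|: T -> (forall z, z \in S -> z \in T -> z = u \/ z = v) ->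
  x \in S -> y \in S -> joint_circle P Q.
Proof.
move=> eP eQ dPQ mPQ p q CE dAB VE m xS yS.
have [A1 [A2 [S1 [S2 [p1 p2 AE SE m12]]]]] := spath_split p xS.
have xy := ear_neq eQ.
move: (yS); rewrite SE inE => /orP[y1|y2].
  have [A3 [A4 [S3 [S4 [p3 p4 AE' SE' m34]]]]] := spath_split p1 y1.
  subst A1 S1; subst A S.
  have m42 z : z \in S4 -> z \in S2 -> z = x.
    by move=> z4; apply: m12; rewrite inE z4 orbT.
  have m32 z : z \in S3 -> z \in S2 -> False.
    move=> z3 z2; have zx : z = x by apply: m12; rewrite // inE z3.
    case/eqP: xy; rewrite -zx; apply: (m34 z z3).
    by rewrite zx; apply: spath_end p4.
  exact: (joint_circle_nested eP (ear_sym eQ) dPQ mPQ p3 p4 p2 q CE dAB VE m34 m42 m32 m).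
have [A3 [A4 [S3 [S4 [p3 p4 AE' SE' m34]]]]] := spath_split p2 y2.
rewrite AE' setUA in AE; rewrite SE' setUA in SE; subst A S.
have m13 z : z \in S1 -> z \in S3 -> z = x.
  by move=> z1 z3; apply: m12 => //; rewrite SE' inE z3.
have m14 z : z \in S1 -> z \in S4 -> False.
  move=> z1 z4; have zx : z = x by apply: m12; rewrite // SE' inE z4 orbT.
  case/eqP: xy; rewrite -zx; apply: (m34 z _ z4).
  by rewrite zx; apply: spath_start p3.
exact: (joint_circle_nested eP eQ dPQ mPQ p1 p3 p4 q CE dAB VE m13 m34 m14 m).
Qed.

Lemma joint_circle_opposite_arcs P Q SP SQ u v x y A B S T :
  ear C u v P SP -> ear C x y Q SQ -> [disjoint P & Q] ->
  (forall z, z \in SP -> z \in SQ -> z \in vset C) ->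
  spath u v A S -> spath u v B T -> C = A :|: B -> [disjoint A & B] ->
  vset C = S :|: T -> (forall z, z \in S -> z \in T -> z = u \/ z = v) ->
  x \in S -> x \notin T -> y \in T -> y \notin S -> joint_circle P Q.
Proof.
move=> eP eQ dPQ mPQ p q CE dAB VE m xS xT yT yS.
have [A1 [A2 [S1 [S2 [p1 p2 AE SE m12]]]]] := spath_split p xS.
have [B1 [B2 [T1 [T2 [q1 q2 BE TE k12]]]]] := spath_split q yT.
subst A S B T.
exact: (joint_circle_crossing eP eQ dPQ mPQ p1 p2 q1 q2 CE dAB VE m12 k12 m xT yS).
Qed.

Lemma joint_circle_disjoint_ears P Q SP SQ u v x y :
  ear C u v P SP -> ear C x y Q SQ -> [disjoint P & Q] ->
  (forall z, z \in SP -> z \in SQ -> z \in vset C) -> joint_circle P Q.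
Proof.
move=> eP eQ dPQ mPQ; have [cC _ _ _] := bat.
have [A [B [S [T [p q [CE dAB] VE m]]]]] :=
  circle_split nl cC (ear_l eP) (ear_r eP) (ear_neq eP).
have CE' : C = B :|: A by rewrite setUC.
have VE' : vset C = T :|: S by rewrite setUC.
have dBA : [disjoint B & A] by rewrite disjoint_sym.
have m' z : z \in T -> z \in S -> z = u \/ z = v by move=> ? ?; apply: m.
have := ear_l eQ; have := ear_r eQ; rewrite VE !in_setU.
(* Ends on both arcs count for either, so the crossing case remains only when [x] and [y] lie
   strictly inside different arcs. *)
case xS: (x \in S); case yS: (y \in S).
- by move=> _ _; apply: (joint_circle_same_arc eP eQ dPQ mPQ p q).
- move=> /= yT _; case xT: (x \in T).
    by apply: (joint_circle_same_arc eP eQ dPQ mPQ q p CE' dBA VE' m').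
  by apply: (joint_circle_opposite_arcs eP eQ dPQ mPQ p q CE dAB VE m); rewrite ?xT ?yS.
- move=> _ /= xT; case yT: (y \in T).
    by apply: (joint_circle_same_arc eP eQ dPQ mPQ q p CE' dBA VE' m').
  by apply: (joint_circle_opposite_arcs eP eQ dPQ mPQ q p CE' dBA VE' m'); rewrite ?yT ?xS.
by move=> /= yT xT; apply: (joint_circle_same_arc eP eQ dPQ mPQ q p CE' dBA VE' m').
Qed.

End Battery.
End Ears.

(** * Rerouting ears, and an ear through every edge off [C] *)

Section Bridges.
Variables (V E : finType) (s t : E -> V) (C : {set E}).
Implicit Types (f g h : E) (x y z w u v : V) (A B Q R : {set E}).
Implicit Types (S T W : {set V}).

Notation incident := (incident s t).
Notation vset := (vset s t).
Notation spath := (spath s t).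
Notation joins := (joins s t).
Notation ear := (ear s t C).

(** The detour [R] replaces the stretch of [Q] between [a] and [b]; [Q1] and [Q3] are the pieces of
    [Q] before and after it. *)
Lemma ear_reroute u v Q S a b R T S1 S3 Q1 Q3 : ear u v Q S -> spath a b R T ->
  (forall z, z \in T -> z \in vset C :|: S -> z = a \/ z = b) ->
  [disjoint R & C] ->
  spath u a Q1 S1 -> spath b v Q3 S3 -> Q1 \subset Q -> Q3 \subset Q ->
  S1 \subset S -> S3 \subset S -> (forall z, z \in S1 -> z \in S3 -> False) ->
  ear u v (Q1 :|: R :|: Q3) (S1 :|: T :|: S3).
Proof.
move=> eQ pR mR dR p1 p3 sQ1 sQ3 sS1 sS3 m13.
have aS1 := spath_end p1; have bS3 := spath_start p3.
split.
- apply: (spath_cat _ p3).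
    apply: (spath_cat p1 pR) => z z1 zT.
    have [|//|zb] := mR z zT; first by rewrite inE (subsetP sS1 z z1) orbT.
    by case: (m13 z z1); rewrite zb.
  move=> z; rewrite inE => /orP[z1 /(m13 z z1)//|zT z3].
  have [|za|//] := mR z zT; first by rewrite inE (subsetP sS3 z z3) orbT.
  by case: (m13 z) => //; rewrite za.
- exact: ear_neq eQ.
- exact: ear_l eQ.
- exact: ear_r eQ.
- move=> z; rewrite !in_setU => zz zC; apply: (ear_meet eQ) => //.
  case/orP: zz => [/orP[/(subsetP sS1)//|zT]|/(subsetP sS3)//].
  have [|->|->] := mR z zT; first by rewrite inE zC.
    exact: (subsetP sS1).
  exact: (subsetP sS3).
have d := ear_disjoint eQ.
by rewrite !disjoint_setUl dR (disjointWl sQ1 d) (disjointWl sQ3 d).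
Qed.

(** Follow [Q] from [u] to its inner vertex [w], then leave along [R]. The new end [w'] differs from
    [u] because it is off [Q]. *)
Lemma ear_branch u v Q S w w' R T : ear u v Q S -> spath w w' R T ->
  (forall z, z \in T -> z \in vset C :|: S -> z = w \/ z = w') ->
  [disjoint R & C] -> w \in S -> w \notin vset C -> w' \in vset C -> w' \notin S ->
  exists u' v' Q' S', ear u' v' Q' S' /\ R \subset Q'.
Proof.
move=> eQ pR mR dR wS wC w'C w'S.
have [Q1 [Q2 [S1 [S2 [p1 p2 QE SE m12]]]]] := spath_split (ear_path eQ) wS.
have sub z : z \in S1 -> z \in S by rewrite SE inE => ->.
exists u, w', (Q1 :|: R), (S1 :|: T); split; last exact: subsetUr.
split=> //.
- apply: (spath_cat p1 pR) => z z1 zT.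
  have [|//|zw'] := mR z zT; first by rewrite inE sub ?orbT.
  by rewrite -zw' sub in w'S.
- by apply: contraNneq w'S => <-; apply: spath_start (ear_path eQ).
- exact: ear_l eQ.
- move=> z; rewrite in_setU => /orP[z1|zT] zC.
    case: (ear_meet eQ (sub z z1) zC) => [|zv]; first by left.
    case/negP: wC; rewrite -(m12 z z1) // zv; exact: spath_end p2.
  have [|zw|] := mR z zT; [by rewrite inE zC| |by right].
  by rewrite -zw zC in wC.
rewrite disjoint_setUl dR andbT; apply: disjointWl (ear_disjoint eQ).
by rewrite QE subsetUl.
Qed.

(** With both ends on [Q], [R] is a detour of [Q]; with both on [C] but not both on [Q], it is an
    ear itself; otherwise it branches off from an inner vertex of [Q] to [C]. *)
Lemma ear_extend u v Q S w w' R T : ear u v Q S -> spath w w' R T -> w != w' ->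
  (forall z, z \in T -> z \in vset C :|: S -> z = w \/ z = w') ->
  [disjoint R & C] -> w \in vset C :|: S -> w' \in vset C :|: S ->
  exists u' v' Q' S', ear u' v' Q' S' /\ R \subset Q'.
Proof.
move=> eQ pR ww' mR dR; have pR' := spath_rev pR.
have mR' z : z \in T -> z \in vset C :|: S -> z = w' \/ z = w.
  by move=> zT /(mR z zT)[]; auto.
rewrite !in_setU; case wS: (w \in S); case w'S: (w' \in S).
- move=> _ _; have [Q1 [Q2 [S1 [S2 [p1 p2 QE SE m12]]]]] := spath_split (ear_path eQ) wS.
  move: (w'S); rewrite SE inE => /orP[w'1|w'2].
    have [Q3 [Q4 [S3 [S4 [p3 p4 QE' SE' m34]]]]] := spath_split p1 w'1.
    exists u, v, (Q3 :|: R :|: Q2), (S3 :|: T :|: S2); split; last first.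
      by rewrite -setUA setUCA subsetUl.
    apply: (ear_reroute eQ pR' mR' dR p3 p2); rewrite ?QE ?SE ?subsetUr //.
    + by rewrite QE' -setUA subsetUl.
    + by rewrite SE' -setUA subsetUl.
    move=> z z3 z2; have zw : z = w by apply: m12; rewrite // SE' inE z3.
    case/eqP: ww'; rewrite -zw; apply: (m34 z z3).
    by rewrite zw; apply: spath_end p4.
  have [Q3 [Q4 [S3 [S4 [p3 p4 QE' SE' m34]]]]] := spath_split p2 w'2.
  exists u, v, (Q1 :|: R :|: Q4), (S1 :|: T :|: S4); split; last first.
    by rewrite -setUA setUCA subsetUl.
  apply: (ear_reroute eQ pR mR dR p1 p4); rewrite ?QE ?SE ?subsetUl //.
  + by rewrite QE' setUA subsetUr.
  + by rewrite SE' setUA subsetUr.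
  move=> z z1 z4; have zw : z = w by apply: m12; rewrite // SE' inE z4 orbT.
  case/eqP: ww'; rewrite -zw; apply: (m34 z _ z4).
  by rewrite zw; apply: spath_start p3.
- rewrite orbF => _ w'C; case wC: (w \in vset C).
    exists w, w', R, T; split=> //; split=> // z zT zC; apply: mR => //.
    by rewrite inE zC.
  by apply: (ear_branch eQ pR mR dR); rewrite ?wS ?wC ?w'S.
- rewrite orbF => wC _; case w'C: (w' \in vset C).
    exists w, w', R, T; split=> //; split=> // z zT zC; apply: mR => //.
    by rewrite inE zC.
  by apply: (ear_branch eQ pR' mR' dR); rewrite ?wS ?w'C ?w'S.
rewrite !orbF => wC w'C; exists w, w', R, T; split=> //; split=> // z zT zC.
by apply: mR => //; rewrite inE zC.
Qed.

Hypothesis blk : is_block s t.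
Hypothesis nl : forall f, s f != t f.

Lemma joins_neq f x y : joins f x y -> x != y.
Proof.
by move=> jf; apply: contraNneq (nl f) => xy; case/orP: jf => /andP[/eqP-> /eqP->]; rewrite xy.
Qed.

(** Edges of [C] are included so that the property can spread from [e] through the connected
    graph. *)
Definition covered f := f \in C \/ exists u v Q S, ear u v Q S /\ f \in Q.

(** Leave [w] along [f] and stop at the next vertex of [W]; a walk from [z] to [z'] avoiding [w]
    exists since [w] is not a cutpoint. Every edge after [f] has an end off [W], hence is off
    [C]. *)
Lemma branch_path W f g w z z' : joins f w z -> joins g w z' -> f \notin C ->
  w \in W -> z' \in W -> vset C \subset W ->
  exists w' R T, [/\ spath w w' R T, w != w', f \in R /\ [disjoint R & C],
    w' \in W & forall x, x \in T -> x \in W -> x = w \/ x = w'].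
Proof.
move=> jf jg fC wW z'W CW; have zw := joins_neq jf; have z'w := joins_neq jg.
rewrite eq_sym in zw; rewrite eq_sym in z'w.
have [w' [R [T [p w'W wT m]]]] := spath_hit (block_connect_avoid blk jf jg zw z'w) zw z'W.
exists w', (f |: R), (w |: T); split=> //.
- exact: (spath_cons jf p).
- by apply: contraNneq wT => ->; apply: spath_end p.
- split; first by rewrite !inE eqxx.
  rewrite disjoint_setUl disjoints1 fC /= -setI_eq0; apply/eqP/setP=> h.
  rewrite !inE; apply/negP=> /andP[hR hC].
  have [a [aT aw' ha]] := spath_edge_not_end p hR.
  by case/eqP: aw'; apply: m => //; apply: (subsetP CW); apply: mem_vset hC ha.
by move=> x; rewrite !inE => /orP[/eqP->|xT xW]; [left | right; apply: m].
Qed.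

(** A path starting with [f] returns to [C], or to [C] together with the ear through [g]. In the
    first case it is an ear, in the second [ear_extend] puts it on one. *)
Lemma covered_step f g w : covered g -> incident g w -> incident f w -> covered f.
Proof.
move=> cg gw fw; case fC: (f \in C); first by left.
have [z jf] := incident_joins fw; have [z' jg] := incident_joins gw.
right; case: cg => [gC|[u [v [Q [S [eQ gQ]]]]]].
  have [|||//|w' [R [T [p ww' [fR dR] w'C m]]]] := branch_path (W := vset C) jf jg.
  - by rewrite fC.
  - exact: mem_vset gC gw.
  - exact: mem_vset gC (joins_incr jg).
  exists w, w', R, T; split=> //; split=> //; exact: mem_vset gC gw.
have wW : w \in vset C :|: S by rewrite inE (spath_incident (ear_path eQ) gQ gw) orbT.
have z'W : z' \in vset C :|: S.
  by rewrite inE (spath_incident (ear_path eQ) gQ (joins_incr jg)) orbT.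
have [||w' [R [T [p ww' [fR dR] w'C m]]]] := branch_path jf jg _ wW z'W.
- by rewrite fC.
- exact: subsetUl.
have [u' [v' [Q' [S' [eQ' sR]]]]] := ear_extend eQ p ww' m dR wW w'C.
by exists u', v', Q', S'; split=> //; apply: (subsetP sR).
Qed.

Lemma ear_through e f : e \in C -> f \notin C -> exists u v Q S, ear u v Q S /\ f \in Q.
Proof.
move=> eC fC; suff: covered f by case=> // h; rewrite h in fC.
have [[_ con] _] := blk.
suff: forall h, incident h (s f) -> covered h by apply; rewrite /Defs.incident eqxx.
apply: (connect_stable (P := fun x => forall h, incident h x -> covered h) _ (con (s e) (s f))).
  move=> a b ca /adjVP[k jk] h hb.
  exact: (covered_step (ca k (joins_incl jk)) (joins_incr jk) hb).
move=> h hs; apply: (covered_step (g := e) _ _ hs); first by left.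
by rewrite /Defs.incident eqxx.
Qed.

(** * Bridges of [C] and the ears inside them *)

Notation out_component x := [set y | connect (adj_out s t C) x y].

Lemma adj_out_sym : connect_sym (adj_out s t C).
Proof.
apply: sym_connect_sym => x y; rewrite /adj_out adjV_sym andbA [RHS]andbA.
by rewrite [(x \notin _) && _]andbC.
Qed.

Lemma out_component_out x y : x \notin vset C -> y \in out_component x -> y \notin vset C.
Proof.
rewrite inE => xC cxy; apply: (connect_stable (P := fun y => y \notin vset C) _ cxy xC).
by move=> a b _ /and3P[].
Qed.

Lemma out_component_eq x y : y \in out_component x -> out_component x = out_component y.
Proof.
rewrite inE => cxy; apply/setP=> z; rewrite !inE.
exact: (same_connect adj_out_sym cxy).
Qed.

Lemma spath_out_component x y A S : spath x y A S ->
  (forall z, z \in S -> z \in vset C -> z = y) -> x \notin vset C ->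
  forall w, w \in S -> w \notin vset C -> w \in out_component x.
Proof.
elim=> [a|f a c b B T jf p IH aT] m aC w; first by rewrite !inE => /eqP->.
rewrite in_setU1 => /orP[/eqP-> _|wT wC]; first by rewrite inE.
case cC: (c \in vset C).
  have cb : c = b by apply: m => //; rewrite inE (spath_start p) orbT.
  move: p wT; rewrite -cb => p; rewrite (spath_trivial p) inE => /eqP wc.
  by rewrite wc cC in wC.
have ac : c \in out_component a.
  rewrite inE; apply: connect1; rewrite /adj_out aC cC /=.
  by apply/adjVP; exists f.
rewrite (out_component_eq ac); apply: IH; rewrite ?cC //.
by move=> z zT; apply: m; rewrite inE zT orbT.
Qed.

(** Applied to the two halves of an ear cut at a vertex off [C], this confines the ear to a single
    bridge. *)
Lemma spath_in_component x y A S : spath x y A S ->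
  (forall z, z \in S -> z \in vset C -> z = y) -> x \notin vset C ->
  S \subset vset C :|: out_component x
  /\ forall f, f \in A -> exists2 z, z \in out_component x & incident f z.
Proof.
move=> p m xC; split=> [|f fA].
  apply/subsetP=> w wS; rewrite in_setU; case wC: (w \in vset C) => //=.
  by apply: (spath_out_component p); rewrite ?wC.
have [a [aS ay fa]] := spath_edge_not_end p fA; exists a => //.
apply: (spath_out_component p) => //.
by apply: contraNN ay => aC; apply/eqP/m.
Qed.

(** The tags put chords and components into one set whose cardinality is [num_bridges]. *)
Definition bridges : {set E + {set V}} :=
  [set inl h | h in chords s t C] :|: [set inr D | D in out_components s t C].

Definition bridge_edges (b : E + {set V}) : {set E} :=
  match b with
  | inl h => [set h]
  | inr D => [set f | [exists x in D, incident f x]]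
  end.

Definition bridge_inner (b : E + {set V}) : {set V} :=
  match b with inl _ => set0 | inr D => D end.

Lemma card_bridges : #|bridges| = num_bridges s t C.
Proof.
rewrite /bridges; set X := inl @: _; set Y := inr @: _.
have XY0 : X :&: Y = set0.
  apply/setP=> b; rewrite in_setI in_set0.
  by apply/negP=> /andP[/imsetP[h _ ->] /imsetP[]].
have inl_inj : injective (@inl E {set V}) by move=> ? ? [].
have inr_inj : injective (@inr E {set V}) by move=> ? ? [].
by rewrite cardsU XY0 cards0 subn0 (card_imset _ inl_inj) (card_imset _ inr_inj).
Qed.

Lemma bridgesP b : b \in bridges ->
  (exists2 h, h \in chords s t C & b = inl h) \/
  (exists2 x, x \notin vset C & b = inr (out_component x)).
Proof.
rewrite in_setU => /orP[/imsetP[h hC ->]|/imsetP[D DC ->]]; first by left; exists h.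
by right; case/imsetP: DC => x xC ->; exists x => //; rewrite inE in xC.
Qed.

(** Without loops, an edge off [C] that is not a chord has an end off [C], and the component of that
    end is its bridge. *)
Lemma bridge_cover f : f \notin C -> exists2 b, b \in bridges & f \in bridge_edges b.
Proof.
move=> fC; case ch: (f \in chords s t C).
  by exists (inl f); rewrite ?in_setU ?in_set1 ?eqxx // imset_f.
suff [x fx xC] : exists2 x, incident f x & x \notin vset C.
  exists (inr (out_component x)); last first.
    by rewrite inE; apply/existsP; exists x; rewrite inE connect0.
  rewrite in_setU; apply/orP; right; apply: imset_f.
  by apply: (imset_f (fun x => out_component x)); rewrite inE.
case sC: (s f \in vset C); last first.
  by exists (s f); rewrite ?sC // /Defs.incident eqxx.
case tC: (t f \in vset C); last first.
  by exists (t f); rewrite ?tC // /Defs.incident eqxx orbT.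
by rewrite inE fC sC tC nl in ch.
Qed.

Lemma bridge_edges_not_in b f : b \in bridges -> f \in bridge_edges b -> f \notin C.
Proof.
case/bridgesP=> [[h hC ->]|[x xC ->]] /=.
  by rewrite inE => /eqP->; rewrite inE in hC; case/and4P: hC.
rewrite inE => /existsP[y /andP[yD fy]].
by apply: contra (out_component_out xC yD) => fC; apply: mem_vset fC fy.
Qed.

Lemma bridge_ear e b f : e \in C -> b \in bridges -> f \in bridge_edges b ->
  exists u v Q S, [/\ ear u v Q S, f \in Q, Q \subset bridge_edges b
    & S \subset vset C :|: bridge_inner b].
Proof.
move=> eC bB fb; have fC := bridge_edges_not_in bB fb.
case/bridgesP: bB fb => [[h hC ->]|[x xC ->]] /=.
  rewrite inE => /eqP fh; subst h; rewrite inE in hC; case/and4P: hC => _ sC tC st.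
  exists (s f), (t f), [set f], [set s f; t f]; split; rewrite ?inE //.
  - split=> //; first exact: (spath_edge (joins_st s t f)).
      by move=> z; rewrite in_set2 => /orP[/eqP|/eqP]; auto.
    by rewrite disjoints1.
  - by apply/subsetP=> z; rewrite in_set2 in_setU => /orP[]/eqP->; rewrite ?sC ?tC.
rewrite inE => /existsP[y /andP[yD fy]]; have yC := out_component_out xC yD.
(* The component is represented by [y], the end of [f] in it: an ear through [f] passes through [y],
   and both its halves stay in that component until they reach [C]. *)
rewrite (out_component_eq yD) => {x xC yD}.
have [u [v [Q [S [eQ fQ]]]]] := ear_through eC fC.
have yS := spath_incident (ear_path eQ) fQ fy.
have [Q1 [Q2 [S1 [S2 [p1 p2 QE SE m12]]]]] := spath_split (ear_path eQ) yS.
have [s1 i1] : S1 \subset vset C :|: out_component y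
    /\ forall f, f \in Q1 -> exists2 z, z \in out_component y & incident f z.
  apply: (spath_in_component (spath_rev p1)) => // z z1 zC.
  have [|//|zv] := ear_meet eQ _ zC; first by rewrite SE inE z1.
  case/negP: yC; rewrite -(m12 z z1) // zv; exact: spath_end p2.
have [s2 i2] : S2 \subset vset C :|: out_component y
    /\ forall f, f \in Q2 -> exists2 z, z \in out_component y & incident f z.
  apply: (spath_in_component p2) => // z z2 zC.
  have [|zu|//] := ear_meet eQ _ zC; first by rewrite SE inE z2 orbT.
  case/negP: yC; rewrite -(m12 z _ z2) // zu; exact: spath_start p1.
exists u, v, Q, S; split=> //; last by rewrite SE subUset s1 s2.
apply/subsetP=> g; rewrite QE !inE => gQ; apply/existsP.
have [z zD gz] : exists2 z, z \in out_component y & incident g z.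
  by case/orP: gQ => [/i1|/i2].
by exists z; rewrite zD.
Qed.

Lemma bridge_edge e b : e \in C -> b \in bridges -> exists f, f \in bridge_edges b.
Proof.
move=> eC /bridgesP[[h hC ->]|[x xC ->]] /=; first by exists h; rewrite inE.
have [f fx] : exists f, incident f x.
  have [[_ con] _] := blk; have /connectP[p] := con x (s e).
  case: p => [|a p] /=.
    by move=> _ <-; exists e; rewrite /Defs.incident eqxx.
  by case/andP=> /adjVP[f jf] _ _; exists f; apply: joins_incl jf.
by exists f; rewrite inE; apply/existsP; exists x; rewrite inE connect0.
Qed.

Lemma bridge_inner_disjoint b b' x : b \in bridges -> b' \in bridges ->
  x \in bridge_inner b -> x \in bridge_inner b' -> b = b'.
Proof.
case/bridgesP=> [[h hC ->]|[y yC ->]]; first by rewrite /= in_set0.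
case/bridgesP=> [[h hC ->]|[z zC ->]]; first by rewrite /= in_set0.
by move=> xy xz; rewrite (out_component_eq xy) (out_component_eq xz).
Qed.

(** A chord has both ends on [C], whereas an edge of a component has an end off [C]; an edge with
    ends in two components would connect them. *)
Lemma bridge_edges_disjoint b b' f : b \in bridges -> b' \in bridges ->
  f \in bridge_edges b -> f \in bridge_edges b' -> b = b'.
Proof.
have mixed h x : h \in chords s t C -> x \notin vset C ->
    f \in bridge_edges (inl h) -> f \in bridge_edges (inr (out_component x)) -> False.
  move=> hC xC /set1P->; rewrite inE in hC; case/and4P: hC => _ sC tC _.
  rewrite inE => /existsP[y /andP[yD fy]].
  by have := out_component_out xC yD; case/orP: fy => /eqP <-; rewrite ?sC ?tC.
case/bridgesP=> [[h hC ->]|[y yC ->]]; case/bridgesP=> [[h' hC' ->]|[z zC ->]].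
- by rewrite !inE => /eqP-> /eqP->.
- by move=> f1 f2; case: (mixed _ _ hC zC).
- by move=> f1 f2; case: (mixed _ _ hC' yC).
rewrite !inE => /existsP[a /andP[ay fa]] /existsP[c /andP[cz fc]].
suff ac : c \in out_component a.
  by rewrite (out_component_eq ay) (out_component_eq ac) (out_component_eq cz).
have [d jd] := incident_joins fa; rewrite inE.
case: (joins_incident jd fc) => [->|cd]; first exact: connect0.
apply: connect1; rewrite /adj_out (out_component_out yC ay) (out_component_out zC cz) /=.
by apply/adjVP; exists f; rewrite cd.
Qed.

End Bridges.

(** * Three bridges give two positive circles through an edge off [C] *)

Theorem mainTheorem6 (V E : finType) (s t : E -> V) (sigma : E -> bool)
    (e : E) (C : {set E}) :
  is_block s t ->
  ~ single_edge s t ->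
  ~ is_circle s t [set: E] ->
  battery_at s t sigma e C ->
  3 <= num_bridges s t C ->
  forall f : E, f \notin C -> ~~ pos_battery s t sigma f.
Proof.
move=> blk _ ncirc bat nb f fC; have nl := block_noloop blk ncirc.
have [_ _ eC _] := bat.
have [b0 b0B fb0] := bridge_cover nl fC.
have [u0 [v0 [P [SP [eP fP sP tP]]]]] := bridge_ear blk nl eC b0B fb0.
have : 1 < #|bridges s t C :\ b0|.
  by move: nb; rewrite -card_bridges (cardsD1 b0) b0B.
case/card_gt1P=> b1 [b2 []]; rewrite !in_setD1 => /andP[b10 b1B] /andP[b20 b2B] b12.
(* Ears in different bridges share no edge and no vertex off [C], as [joint_circle_disjoint_ears]
   requires. *)
have joint b : b != b0 -> b \in bridges s t C -> exists Q, [/\ joint_circle s t sigma C P Q,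
    Q != set0, Q \subset bridge_edges s t b & [disjoint Q & C]].
  move=> bb0 bB; have [g gb] := bridge_edge blk eC bB.
  have [x [y [Q [SQ [eQ gQ sQ tQ]]]]] := bridge_ear blk nl eC bB gb.
  exists Q; split=> //; last exact: ear_disjoint eQ.
    apply: (joint_circle_disjoint_ears nl bat eP eQ).
      apply/pred0P=> h /=; apply/negP=> /andP[/(subsetP sP) h0 /(subsetP sQ) h1].
      by case/eqP: bb0; apply: (bridge_edges_disjoint bB b0B h1 h0).
    move=> z /(subsetP tP); rewrite in_setU => /orP[//|z0].
    move=> /(subsetP tQ); rewrite in_setU => /orP[//|z1].
    by case/eqP: bb0; apply: (bridge_inner_disjoint bB b0B z1 z0).
  by apply/set0Pn; exists g.
have [Q1 [[Z1 [cZ1 nZ1 PZ1 QZ1 ZU1]] _ sQ1 _]] := joint b1 b10 b1B.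
have [Q2 [[Z2 [cZ2 nZ2 PZ2 QZ2 ZU2]] /set0Pn[q qQ2] sQ2 dQ2]] := joint b2 b20 b2B.
apply/negP=> /cards1P[Z ZE].
(* If [f] were a battery, any positive circle containing [P], and with it [f], would be this [Z]. *)
have inZ D : is_circle s t D -> ~~ neg sigma D -> P \subset D -> D = Z.
  move=> cD nD PD; apply/set1P; rewrite -ZE inE; apply/and3P; split=> //.
  exact: (subsetP PD).
(* An edge [q] of [Q2] then lies in [Z1], hence in [P], [Q1] or [C]. But [q] is off [C], and its
   bridge [b2] shares no edge with [b0] or [b1]. *)
have Z12 : Z2 = Z1 by rewrite (inZ _ cZ1 nZ1 PZ1) (inZ _ cZ2 nZ2 PZ2).
have := subsetP ZU1 q; rewrite -Z12 (subsetP QZ2 q qQ2) => /(_ isT).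
have qb2 := subsetP sQ2 q qQ2.
rewrite !in_setU (disjointFr dQ2 qQ2) orbF => /orP[/(subsetP sP)|/(subsetP sQ1)] qb.
  by case/eqP: b20; apply: (bridge_edges_disjoint b2B b0B qb2 qb).
by case/eqP: b12; apply: (bridge_edges_disjoint b1B b2B qb qb2).
Qed.
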